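(* For $N\ge1$ and $\theta,\phi\in(0,\pi)\setminus\Theta_F$ with $\theta\ne\phi$, $$(x_\theta-x_\phi)\,\Psi_\theta^*P_N\Psi_\phi=a\bigl(G_\theta(N+1)^*G_\phi(N)-G_\theta(N)^*G_\phi(N+1)\bigr).$$ For every $\theta\in(0,\pi)\setminus\Theta_F$ one has $$S_\theta^*S_\theta=I_r .$$ Moreover, with $\dot S_\theta=\partial_\theta S(e^{i\theta})$, for every $N\ge1$ and $\theta\in(0,\pi)\setminus\Theta_F$, $$\Psi_\theta^*P_N\Psi_\theta=(2N+1)I_r+iS_\theta^*\dot S_\theta+\frac{i}{2\sin\theta}\left(e^{-i(2N+1)\theta}S_\theta-e^{i(2N+1)\theta}S_\theta^*\right).$$ In particular, every term on the right-hand side of the last formula is Hermitian.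
   Context: Let $q$ be a prime power, $a=\sqrt q$, $d,r\ge1$ integers, $H_C=H_C^*$ a complex $d\times d$ matrix, and $V:\mathbb C^r\to\mathbb C^d$ linear. Let $\mathscr H=\mathbb C^d\oplus\bigoplus_{c=1}^r\ell^2(\mathbb N)$, $\mathbb N=\{1,2,\dots\}$; write elements as $(u,g)$ with $g(n)=(g_1(n),\dots,g_r(n))^t\in\mathbb C^r$. The bounded self-adjoint operator $J$ is $J(u,g)=(H_Cu+Vg(1),\,h)$, where $h(1)=a\,g(2)+V^*u$ and $h(n)=a\{g(n-1)+g(n+1)\}$ for $n\ge2$. For $\zeta\in\mathbb C^\times$ put $x(\zeta)=a(\zeta+\zeta^{-1})$, $$F(\zeta)=H_C-x(\zeta)I_d+\frac{\zeta^{-1}}{a}VV^*,\qquad S(\zeta)=-I_r+\frac{\zeta^{-1}-\zeta}{a}V^*F(\zeta)^{-1}V,$$ and for $\alpha\in\mathbb C^r$ $$\Psi(\zeta)\alpha=\Bigl((\zeta^{-1}-\zeta)F(\zeta)^{-1}V\alpha,\ \bigl(\zeta^n\alpha+\zeta^{-n}S(\zeta)\alpha\bigr)_{n\ge1}\Bigr),$$ a (not square-summable) solution of $Jf=x(\zeta)f$. Let $\Theta_F=\{\theta\in(0,\pi):\det F(e^{i\theta})=0\}$, a finite set. For $\theta\in(0,\pi)\setminus\Theta_F$ write $x_\theta=2a\cos\theta$, $S_\theta=S(e^{i\theta})$, $\Psi_\theta=\Psi(e^{i\theta})$ and $G_\theta(n)=e^{in\theta}I_r+e^{-in\theta}S_\theta$.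 $P_N$ is the coordinate projection onto the finite core $\mathbb C^d$ and the coordinates $1,\dots,N$ of every tail. $\Psi_\theta^*P_N\Psi_\phi$ is the $r\times r$ matrix with $(c,d)$ entry $\langle P_N\Psi_\phi e_d,\Psi_\theta e_c\rangle$ (a finite sum), with inner products linear in the first variable and $e_c$ the standard vectors of $\mathbb C^r$. *)

(* Defs.v *)
From mathcomp Require Import all_boot all_order all_algebra.
From mathcomp Require Import complex.
From mathcomp Require Import all_classical all_reals all_analysis.

Set Implicit Arguments.
Unset Strict Implicit.
Unset Printing Implicit Defensive.

Import Order.TTheory GRing.Theory Num.Theory.
Import numFieldNormedType.Exports.

Local Open Scope classical_set_scope.
Local Open Scope ring_scope.
Local Open Scope sesquilinear_scope.
Local Open Scope complex_scope.

Definition prime_power (q : nat) : Prop :=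
  exists p k : nat, [/\ prime p, (0 < k)%N & q = (p ^ k)%N].

(* e^{it} *)
Definition expi (R : realType) (t : R) : R[i] := cos t +i* sin t.

Definition xz (R : realType) (a : R) (z : R[i]) : R[i] := a%:C * (z + z^-1).

Definition Fmx (R : realType) (d r : nat) (a : R)
    (HC : 'M[R[i]]_d) (V : 'M[R[i]]_(d, r)) (z : R[i]) : 'M[R[i]]_d :=
  HC - (xz a z)%:M + (z^-1 / a%:C) *: (V *m V^t*).

(* Only meaningful where [Fmx a HC V z] is invertible: [invmx] is the identity
   on singular matrices. *)
Definition Smx (R : realType) (d r : nat) (a : R)
    (HC : 'M[R[i]]_d) (V : 'M[R[i]]_(d, r)) (z : R[i]) : 'M[R[i]]_r :=
  - 1%:M + ((z^-1 - z) / a%:C) *: (V^t* *m invmx (Fmx a HC V z) *m V).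

(* Core component [u] and tails [g]. The tails are indexed by {1, 2, ...}: the
   value of [g] at 0 is junk, ignored by [projN] and [inner]. No summability is
   imposed, since the generalized eigenfunctions are not square-summable. *)
Definition state (R : realType) (d r : nat) : Type :=
  ('cV[R[i]]_d * (nat -> 'cV[R[i]]_r))%type.

Definition Psi (R : realType) (d r : nat) (a : R)
    (HC : 'M[R[i]]_d) (V : 'M[R[i]]_(d, r)) (z : R[i]) (alpha : 'cV[R[i]]_r) :
    state R d r :=
  ((z^-1 - z) *: (invmx (Fmx a HC V z) *m V *m alpha),
   fun n => z ^+ n *: alpha + z ^- n *: (Smx a HC V z *m alpha)).

Definition projN (R : realType) (d r N : nat) (f : state R d r) : state R d r :=
  (f.1, fun n => if (1 <= n <= N)%N then f.2 n else 0).

(* Linear in the first variable. The sum over the tail is a finite-support sum,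
   which is all that is needed as soon as one argument is of the form
   [projN N f]. *)
Definition inner (R : realType) (d r : nat) (f g : state R d r) : R[i] :=
  \sum_(j < d) f.1 j 0 * (g.1 j 0)^* +
  \sum_(n \in [set n : nat | (1 <= n)%N])
     \sum_(c < r) f.2 n c 0 * (g.2 n c 0)^*.

Definition ThetaF (R : realType) (d r : nat) (a : R)
    (HC : 'M[R[i]]_d) (V : 'M[R[i]]_(d, r)) : set R :=
  [set t | 0 < t < pi /\ \det (Fmx a HC V (expi t)) = 0].

(* (0, pi) \ Theta_F *)
Definition regular_angle (R : realType) (d r : nat) (a : R)
    (HC : 'M[R[i]]_d) (V : 'M[R[i]]_(d, r)) : set R :=
  [set t | 0 < t < pi] `\` ThetaF a HC V.

Definition xth (R : realType) (a t : R) : R := 2 * a * cos t.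

Definition Sth (R : realType) (d r : nat) (a : R)
    (HC : 'M[R[i]]_d) (V : 'M[R[i]]_(d, r)) (t : R) : 'M[R[i]]_r :=
  Smx a HC V (expi t).

Definition Gth (R : realType) (d r : nat) (a : R)
    (HC : 'M[R[i]]_d) (V : 'M[R[i]]_(d, r)) (t : R) (n : nat) : 'M[R[i]]_r :=
  (expi (n%:R * t))%:M + expi (- (n%:R * t)) *: Sth a HC V t.

(* Psi_s^* P_N Psi_t *)
Definition overlap (R : realType) (d r : nat) (a : R)
    (HC : 'M[R[i]]_d) (V : 'M[R[i]]_(d, r)) (N : nat) (s t : R) :
    'M[R[i]]_r :=
  \matrix_(c < r, e < r)
    inner (projN N (Psi a HC V (expi t) (delta_mx e 0)))
          (Psi a HC V (expi s) (delta_mx c 0)).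

(* Derivative of a complex-valued function of a real variable, as a limit of
   difference quotients for the modulus topology of R[i]; the library's [derive]
   would need a normed module structure over R on R[i]. The alias R[i]^o is what
   carries the topology. *)
Definition cquot (R : realType) (f : R -> R[i]) (t h : R) : R[i]^o :=
  (f (t + h) - f t) / h%:C.

Definition cderivable (R : realType) (f : R -> R[i]) (t : R) : Prop :=
  cvg (cquot f t @ 0^').

Definition cderive (R : realType) (f : R -> R[i]) (t : R) : R[i] :=
  lim (cquot f t @ 0^').

Definition mxderivable (R : realType) (r : nat) (M : R -> 'M[R[i]]_r) (t : R) :
    Prop :=
  forall c e : 'I_r, cderivable (fun u => M u c e) t.

Definition mxderive (R : realType) (r : nat) (M : R -> 'M[R[i]]_r) (t : R) :
    'M[R[i]]_r :=
  \matrix_(c < r, e < r) cderive (fun u => M u c e) t.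

(* Main.v *)
(** Write [A t] for the core part of [Psi_t].  The equations [F A = (z^-1 - z) V]
and [S = -1 + a^-1 V^* A] amount to [H_C A + V G(1) = x A], [V^* A = a G(0)],
and [G] satisfies the three-term recurrence of [J].  Summation by parts then
gives the Wronskian identity for all [N >= 0], also when the two angles coincide,
and unitarity of [S] is the case [s = t], [N = 0].  The diagonal formula is
obtained by differentiating the Wronskian identity in [t] at [t = s], where the
scalar factor vanishes so that only its derivative [2 a sin s] contributes. *)

Require Import Defs.
From mathcomp Require Import all_boot all_order all_algebra.
From mathcomp Require Import complex.
From mathcomp Require Import all_classical all_reals all_analysis.
From mathcomp Require Import perm ring.

Set Implicit Arguments.
Unset Strict Implicit.
Unset Printing Implicit Defensive.

Import Order.TTheory GRing.Theory Num.Theory.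
Import numFieldNormedType.Exports.

Local Open Scope classical_set_scope.
Local Open Scope ring_scope.
Local Open Scope sesquilinear_scope.
Local Open Scope complex_scope.

(** * Adjoints, and the algebraic Wronskian identities *)

Lemma adjmxM (C : numClosedFieldType) m n p (A : 'M[C]_(m, n)) (B : 'M[C]_(n, p)) :
  (A *m B)^t* = B^t* *m A^t*.
Proof. by rewrite trmx_mul map_mxM. Qed.

Lemma adjmxD (C : numClosedFieldType) m n (A B : 'M[C]_(m, n)) :
  (A + B)^t* = A^t* + B^t*.
Proof. by rewrite linearD map_mxD. Qed.

Lemma adjmxZ (C : numClosedFieldType) m n c (A : 'M[C]_(m, n)) :
  (c *: A)^t* = (c^* )%R *: A^t*.
Proof. by rewrite linearZ map_mxZ. Qed.

Lemma adjmxB (C : numClosedFieldType) m n (A B : 'M[C]_(m, n)) :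
  (A - B)^t* = A^t* - B^t*.
Proof. by rewrite linearB map_mxB. Qed.

Lemma adjmx_sum (C : numClosedFieldType) m n (I : Type) (s : seq I)
    (A : I -> 'M[C]_(m, n)) :
  (\sum_(i <- s) A i)^t* = \sum_(i <- s) (A i)^t*.
Proof. by rewrite linear_sum map_mx_sum. Qed.

Lemma adjmxK (C : numClosedFieldType) m n (A : 'M[C]_(m, n)) : (A^t* )^t* = A.
Proof. by rewrite map_trmx trmxK map_mxCK. Qed.

Lemma adjmx_scalar (C : numClosedFieldType) n (c : C) :
  (c%:M : 'M[C]_n)^t* = ((c^* )%R)%:M.
Proof. by rewrite tr_scalar_mx map_scalar_mx. Qed.

Lemma hermsymmxP (C : numClosedFieldType) n (A : 'M[C]_n) :
  A \is hermsymmx <-> A^t* = A.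
Proof. by rewrite qualifE /= expr0 scale1r eq_sym; split=> /eqP. Qed.

Lemma mulmx_deltaE (T : pzRingType) m n (A : 'M[T]_(m, n)) i j :
  (A *m (delta_mx j 0 : 'cV_n)) i 0 = A i j.
Proof. by rewrite -colE mxE. Qed.

Lemma adjmx_mulE (C : numClosedFieldType) m n p
    (A : 'M[C]_(m, n)) (B : 'M[C]_(m, p)) i j :
  (A^t* *m B) i j = \sum_k B k j * ((A k i)^* )%R.
Proof. by rewrite mxE; apply: eq_bigr => k _; rewrite !mxE mulrC. Qed.

(** Summation by parts, as an induction on [N]. Stated for abstract blocks, with no relation between
    [xs] and [xt], so that equal angles are covered as well. *)
Lemma truncated_green (C : numClosedFieldType) d r (a xs xt : C)
    (H : 'M[C]_d) (V : 'M[C]_(d, r)) (As At : 'M[C]_(d, r))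
    (Gs Gt : nat -> 'M[C]_r) (N : nat) :
  (a^* )%R = a -> (xs^* )%R = xs -> H^t* = H ->
  H *m As + V *m Gs 1 = xs *: As -> V^t* *m As = a *: Gs 0 ->
  (forall n, a *: (Gs n + Gs n.+2) = xs *: Gs n.+1) ->
  H *m At + V *m Gt 1 = xt *: At -> V^t* *m At = a *: Gt 0 ->
  (forall n, a *: (Gt n + Gt n.+2) = xt *: Gt n.+1) ->
  (xs - xt) *: (As^t* *m At + \sum_(1 <= n < N.+1) (Gs n)^t* *m Gt n) =
  a *: ((Gs N.+1)^t* *m Gt N - (Gs N)^t* *m Gt N.+1).
Proof.
move=> ra rx rH cs bs recs ct bt rect.
have csH : As^t* *m H + (Gs 1)^t* *m V^t* = xs *: As^t*.
  by rewrite -{1}rx -adjmxZ -cs adjmxD !adjmxM rH.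
have bsH : As^t* *m V = a *: (Gs 0)^t*.
  by rewrite -{1}ra -adjmxZ -bs adjmxM adjmxK.
have recsH n : a *: ((Gs n)^t* + (Gs n.+2)^t*) = xs *: (Gs n.+1)^t*.
  by rewrite -adjmxD -{1}ra -{1}rx -!adjmxZ recs.
elim: N => [|N IHN].
  (* Core terms only: the two copies of [As^t* *m H *m At] cancel, and [bsH] and [bt] turn the
     coupling through [V] into the boundary values at sites 0 and 1. *)
  rewrite big_geq// addr0 scalerBl scalemxAl scalemxAr -csH -ct.
  rewrite mulmxDl mulmxDr !mulmxA bsH -(mulmxA _ (V^t*)) bt.
  rewrite -scalemxAl -scalemxAr opprD addrACA subrr add0r.
  by rewrite scalerBr.
(* Both recurrences are applied to the new term at site [N.+1]; its part at sites [N], [N.+1]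
   cancels the inductive boundary term. *)
rewrite big_nat_recr//= addrA scalerDr IHN scalerBl scalemxAl scalemxAr -recsH -rect.
rewrite -scalemxAl -scalemxAr mulmxDl mulmxDr -scalerBr -scalerDr; congr (_ *: _).
by rewrite opprD [X in _ + X]addrACA !addrA subrK subrr add0r.
Qed.

Lemma adj_plane_wave (C : numClosedFieldType) r (z : C) (S : 'M[C]_r) n :
  (z^* )%R = z^-1 ->
  ((z ^+ n)%:M + z ^- n *: S)^t* = (z ^- n)%:M + z ^+ n *: S^t*.
Proof.
move=> cz; have conjX : ((z ^+ n)^* )%R = z ^- n by rewrite rmorphXn /= cz exprVn.
by rewrite adjmxD adjmxZ adjmx_scalar fmorphV /= conjX invrK.
Qed.

(** Expanding, [G1^t* *m G0 - G0^t* *m G1] equals [(z - z^-1) *: (S^t* *m S - 1%:M)]. *)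
Lemma unitary_of_wronskian (C : numClosedFieldType) r (z : C)
    (S G0 G1 : 'M[C]_r) :
  (z^* )%R = z^-1 -> z - z^-1 != 0 ->
  G0 = 1%:M + S -> G1 = z%:M + z^-1 *: S ->
  G1^t* *m G0 = G0^t* *m G1 -> S^t* *m S = 1%:M.
Proof.
move=> cz zV -> -> /eqP; rewrite -subr_eq0 => /eqP.
have := adj_plane_wave S 0 cz; have := adj_plane_wave S 1 cz.
rewrite !expr0 !expr1 !invr1 !scale1r => -> ->.
rewrite !mulmxDl !mulmxDr !mul_scalar_mx ?scale1r.
rewrite !mulmx1 !mul_mx_scalar -!scalemxAl -!scalemxAr.
(* The identity is linear in [S], its adjoint and their product, so these can be treated as
   independent matrices and compared entrywise in the commutative field. *)
move: (S^t* ) (S^t* *m S) => h p /matrixP e.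
apply/matrixP => i j; have := e i j; rewrite !mxE => eij.
apply: (mulfI zV); rewrite -[RHS]addr0 -{}eij.
move: (S i j) (h i j) (p i j) => gij hij pij.
by case: (i == j); rewrite ?mulr1n ?mulr0n; ring.
Qed.

(** Used with [z = expi t], [iu = 'i] and [w = 2 sin t]: the right-hand factors are then the angular
    derivatives of [G t N] and [G t N.+1]. The terms in [dS] alone cancel, and unitarity merges the
    diagonal terms into [2 * N + 1]. *)
Lemma diagonal_wronskian (C : numClosedFieldType) r (z : C) (iu w : C)
    (S dS : 'M[C]_r) (N : nat) :
  (z^* )%R = z^-1 -> z != 0 -> S^t* *m S = 1%:M -> iu ^+ 2 = -1 ->
  z - z^-1 = iu * w -> w != 0 ->
  ((z ^+ N.+1)%:M + z ^- N.+1 *: S)^t* *m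
     ((iu * N%:R * z ^+ N)%:M - (iu * N%:R * z ^- N) *: S + z ^- N *: dS) -
  ((z ^+ N)%:M + z ^- N *: S)^t* *m
     ((iu * N.+1%:R * z ^+ N.+1)%:M - (iu * N.+1%:R * z ^- N.+1) *: S
       + z ^- N.+1 *: dS) =
  w *: (((2 * N + 1)%:R)%:M + iu *: (S^t* *m dS) +
        (iu / w) *: (z ^- (2 * N + 1) *: S - z ^+ (2 * N + 1) *: S^t*)).
Proof.
move=> cz z0 uS iu2 zw w0; rewrite !adj_plane_wave//.
rewrite !mulmxDl !mulmxDr !mulmxN !mul_scalar_mx -!scalemxAl -!scalemxAr uS.
rewrite !mul_mx_scalar.
move: (S^t* ) (S^t* *m dS) => h p.
apply/matrixP => i j; rewrite !mxE.
move: (S i j) (dS i j) (h i j) (p i j) => gij dij hij pij.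
have zN : z ^+ N != 0 by rewrite expf_neq0.
rewrite mulnC exprD exprM expr1 !exprS expr0 mulr1.
rewrite -[in N.+1%:R]addn1 !natrD natrM.
rewrite 2!(mulrDr w) [w * (iu * pij)]mulrA [w * iu]mulrC -zw.
rewrite [w * (iu / w * _)]mulrA [w * (iu / w)]mulrCA divff// mulr1.
(* With [w] eliminated, what remains is a rational identity in [z] that holds without using
   [iu ^+ 2 = -1]. *)
have -> : w = - iu * (z - z^-1).
  by rewrite zw mulrA mulNr -expr2 iu2 opprK mul1r.
move: z0 zN; move: (z ^+ N) (N%:R : C) => zN n z0 zN0.
by case: (i == j); rewrite ?mulr1n ?mulr0n; field; rewrite z0 zN0.
Qed.

(** * The unit circle *)

Section Expi.
Variable R : realType.
Implicit Types s t : R.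

Lemma expi0 : expi (0 : R) = 1.
Proof. by rewrite /expi cos0 sin0. Qed.

Lemma expiD s t : expi (s + t) = expi s * expi t.
Proof.
by apply/eqP; rewrite eq_complex /= cosD sinD eqxx /= addrC.
Qed.

Lemma expi_neq0 t : expi t != 0.
Proof.
apply/eqP => t0; have := expiD t (- t).
by rewrite subrr expi0 t0 mul0r => /eqP; rewrite oner_eq0.
Qed.

Lemma expiN t : expi (- t) = (expi t)^-1.
Proof.
apply: (mulfI (expi_neq0 t)).
by rewrite -expiD subrr expi0 divff// expi_neq0.
Qed.

Lemma expiMn n t : expi (n%:R * t) = expi t ^+ n.
Proof.
elim: n => [|n IHn]; first by rewrite mul0r expi0.
by rewrite exprS -IHn -expiD -nat1r mulrDl mul1r.
Qed.

Lemma conj_expi t : ((expi t)^*)%R = (expi t)^-1.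
Proof. by rewrite -expiN /expi cosN sinN. Qed.

Lemma conj_realC (x : R) : ((x%:C)^*)%R = x%:C.
Proof. exact: conjc_real. Qed.

Lemma conj_i : (('i : R[i])^* )%R = - 'i.
Proof.
by rewrite -[LHS]/(conjc 'i) /=; apply/eqP; rewrite eq_complex /= oppr0 !eqxx.
Qed.

Lemma expi_addV t : expi t + (expi t)^-1 = (2 * cos t)%:C.
Proof.
rewrite -expiN /expi cosN sinN; apply/eqP.
by rewrite eq_complex /= subrr eqxx andbT mulr2n mulrDl mul1r.
Qed.

Lemma expi_subV t : expi t - (expi t)^-1 = 'i * (2 * sin t)%:C.
Proof.
rewrite -expiN /expi cosN sinN; apply/eqP.
rewrite eq_complex /= opprK !mul0r !mul1r !subrr add0r eqxx /=.
by rewrite mulr2n mulrDl mul1r.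
Qed.
End Expi.

(** * Derivatives of complex functions of a real variable *)

Section Calculus.
Variable R : realType.
Implicit Types (f g : R -> R[i]) (t : R) (l : R[i]).

(** A relational derivative: each rule below gives existence and value at once, and uniqueness of
    limits lets two computed values be equated. *)
Definition cder f t l := cquot f t @ 0^' --> (l : R[i]^o).

Lemma near_cvg_eq (u v : R -> R[i]^o) (l : R[i]^o) :
  (\forall h \near 0^', u h = v h) -> u @ 0^' --> l -> v @ 0^' --> l.
Proof. by move=> uv; apply: cvg_trans; exact: near_eq_cvg. Qed.

Lemma cderP f t : cderivable f t <-> exists l, cder f t l.
Proof.
split=> [cf|[l fl]]; first by exists (lim (cquot f t @ 0^')).
exact: cvgP fl.
Qed.

Lemma cder_derive f t l : cder f t l -> cderive f t = l.
Proof. by move=> fl; apply: cvg_lim fl. Qed.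

Lemma cder_uniq f t l l' : cder f t l -> cder f t l' -> l = l'.
Proof. by move=> /cder_derive <- /cder_derive <-. Qed.

Lemma norm_realC (x : R) : `|x%:C| = `|x|%:C.
Proof. by rewrite normc_def /= expr0n addr0 sqrtr_sqr. Qed.

Lemma cvg_realC (T : Type) (F : set_system T) (FF : Filter F) (u : T -> R) (x : R) :
  u @ F --> x -> (fun y => (u y)%:C : R[i]^o) @ F --> (x%:C : R[i]^o).
Proof.
move=> /cvgrPdist_lt ux; apply/cvgrPdist_lt => -[e e'].
(* A positive element of [R[i]] has zero imaginary part, so the radius is real. *)
rewrite ltcE /= => /andP[/eqP -> e0].
near=> y; rewrite -[_ - _](rmorphB (real_complex R)) norm_realC ltcR.
by near: y; exact: ux.
Unshelve. all: by end_near. Qed.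

(** The filter [0^'] omits [h = 0], while [f t] enters every quotient; agreement at [t] is therefore
    a separate hypothesis. *)
Lemma cder_near f g t l : (\forall h \near 0^', f (t + h) = g (t + h)) ->
  f t = g t -> cder f t l -> cder g t l.
Proof.
move=> fg fgt; apply: near_cvg_eq; near=> h.
by rewrite /cquot fgt; congr ((_ - _) / _); near: h.
Unshelve. all: by end_near. Qed.

Lemma cder_ext f g t l : f =1 g -> cder f t l -> cder g t l.
Proof.
by move=> fg; apply: cder_near; [near=> h; rewrite fg | rewrite fg].
Unshelve. all: by end_near. Qed.

(** Differentiability gives continuity, since [f (t + h)] is [f t] plus [h] times the quotient. *)
Lemma cder_cvg f t l : cder f t l ->
  (fun h => f (t + h) : R[i]^o) @ 0^' --> (f t : R[i]^o).
Proof.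
move=> fl; rewrite -[f t]addr0 -(mul0r l).
have h0 : (fun h : R => h%:C : R[i]^o) @ 0^' --> (0%:C : R[i]^o).
  by apply: cvg_realC; apply: cvg_within_filter; exact: cvg_id.
apply: near_cvg_eq (cvgD (cvg_cst (f t : R[i]^o)) (cvgM h0 fl)).
near=> h; rewrite -[LHS]/(f t + h%:C * ((f (t + h) - f t) / h%:C)).
rewrite mulrC mulfVK; first by rewrite addrC subrK.
rewrite eq_complex /= eqxx andbT; near: h; exact: nbhs_dnbhs_neq.
Unshelve. all: by end_near. Qed.

Lemma cder_cst (c : R[i]) t : cder (fun=> c) t 0.
Proof.
rewrite /cder (_ : cquot _ _ = fun=> 0); first exact: cvg_cst.
by apply/funext => h; rewrite /cquot subrr mul0r.
Qed.

Lemma cderD f g t l l' :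
  cder f t l -> cder g t l' -> cder (fun x => f x + g x) t (l + l').
Proof.
move=> fl gm; apply: near_cvg_eq (cvgD fl gm).
near=> h; rewrite -[LHS]/(cquot f t h + cquot g t h) /cquot.
by rewrite -mulrDl opprD addrACA.
Unshelve. all: by end_near. Qed.

Lemma cderM f g t l l' : cder f t l -> cder g t l' ->
  cder (fun x => f x * g x) t (l * g t + f t * l').
Proof.
move=> fl gm.
apply: near_cvg_eq
  (cvgD (cvgM fl (cder_cvg gm)) (cvgM (cvg_cst (f t : R[i]^o)) gm)).
near=> h.
rewrite -[LHS]/(cquot f t h * g (t + h) + f t * cquot g t h) /cquot.
by ring.
Unshelve. all: by end_near. Qed.

Lemma cderZ c f t l : cder f t l -> cder (fun x => c * f x) t (c * l).
Proof. by move=> fl; have := cderM (cder_cst c t) fl; rewrite mul0r add0r. Qed.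

Lemma cderN f t l : cder f t l -> cder (fun x => - f x) t (- l).
Proof.
move=> fl; rewrite -mulN1r; apply: cder_ext (@cderZ (-1) _ _ _ fl) => x.
by rewrite mulN1r.
Qed.

Lemma cder_sum (I : Type) (r : seq I) (P : pred I) (f : I -> R -> R[i]) t
    (l : I -> R[i]) : (forall i, cder (f i) t (l i)) ->
  cder (fun x => \sum_(i <- r | P i) f i x) t (\sum_(i <- r | P i) l i).
Proof.
move=> fl; elim: r => [|i r IHr].
  by rewrite big_nil; apply: cder_ext (cder_cst 0 t) => x; rewrite big_nil.
rewrite big_cons; case: ifPn => Pi.
  by apply: cder_ext (cderD (fl i) IHr) => x; rewrite big_cons Pi.
by apply: cder_ext IHr => x; rewrite big_cons (negPf Pi).
Qed.

Lemma cder_neq0 f t l : cder f t l -> f t != 0 ->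
  \forall h \near 0^', f (t + h) != 0.
Proof.
by move=> /cder_cvg ft f0; exact: (@cvgr_neq0 _ R[i]^o _ _ _ _ _ ft f0).
Qed.

Lemma cderV f t l : f t != 0 -> cder f t l ->
  cder (fun x => (f x)^-1) t (- l * (f t)^-1 * (f t)^-1).
Proof.
move=> f0 fl; apply: near_cvg_eq (cvgM (cvgM (cvgN fl) (cvgV f0 (cder_cvg fl)))
  (cvg_cst ((f t)^-1 : R[i]^o))).
near=> h.
have fh : f (t + h) != 0 by near: h; exact: cder_neq0 fl f0.
rewrite -[LHS]/(- cquot f t h * (f (t + h))^-1 * (f t)^-1) /cquot.
have -> : (f (t + h))^-1 - (f t)^-1 =
    - (f (t + h) - f t) / f (t + h) / f t by field; rewrite fh f0.
by ring.
Unshelve. all: by end_near. Qed.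

(** The bridge through which the library derivatives of [cos] and [sin] enter. *)
Lemma cder_real (u : R -> R) t (x : R) :
  is_derive t 1 u x -> cder (fun y => (u y)%:C) t x%:C.
Proof.
move=> [du dx]; rewrite -dx.
apply: near_cvg_eq (cvg_realC _ du); near=> h.
rewrite /cquot -rmorphB -fmorphV -rmorphM; congr (_%:C).
by rewrite -[LHS]/(h^-1 * (u (h * 1 + t) - u t)) mulr1 mulrC [h + t]addrC.
Unshelve. all: by end_near. Qed.

Lemma cder_expi (c : R) t :
  cder (fun x => expi (c * x)) t ('i * c%:C * expi (c * t)).
Proof.
have dc : is_derive t 1 (fun x => c * x) c.
  apply: (is_derive_eq (is_deriveZ c (is_derive_id t (1 : R)))).
  exact: mulr1.
have dcos := is_derive1_comp (is_derive_cos (c * t)) dc.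
have dsin := is_derive1_comp (is_derive_sin (c * t)) dc.
have := cderD (cder_real dcos) (@cderZ 'i _ _ _ (cder_real dsin)).
have -> : (- sin (c * t) * c)%:C + 'i * (cos (c * t) * c)%:C =
    'i * c%:C * expi (c * t).
  apply/eqP; rewrite eq_complex /= !(mul0r, mulr0, mul1r, subr0, add0r, addr0).
  by rewrite mulNr ![c * _]mulrC !eqxx.
apply: cder_ext => x; apply/eqP; rewrite eq_complex /=.
by rewrite !(mul0r, mulr0, mul1r, subr0, add0r, addr0) !eqxx.
Qed.

Lemma cder_expi1 t : cder (@expi R) t ('i * expi t).
Proof.
have := @cder_expi 1 t; rewrite rmorph1 mulr1 mul1r.
by apply: cder_ext => x; rewrite mul1r.
Qed.

Lemma cder_expiV t : cder (fun x => (expi x)^-1) t (- 'i * (expi t)^-1).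
Proof.
have := @cder_expi (-1) t; rewrite rmorphN1 mulrN1 mulN1r expiN.
by apply: cder_ext => x; rewrite mulN1r expiN.
Qed.

Lemma cder_xth (a : R) t :
  cder (fun x => (xth a x)%:C) t (- (2 * a * sin t))%:C.
Proof.
apply: cder_real; rewrite /xth -mulrN.
exact: is_derive_eq (is_deriveZ (2 * a) (is_derive_cos t)) erefl.
Qed.

Lemma cderivable_prod (I : Type) (r : seq I) (f : I -> R -> R[i]) t :
  (forall i, cderivable (f i) t) ->
  cderivable (fun x => \prod_(i <- r) f i x) t.
Proof.
move=> df; elim: r => [|i r /cderP[l fl]]; apply/cderP.
  by exists 0; apply: cder_ext (cder_cst 1 t) => x; rewrite big_nil.
have /cderP[m fm] := df i; exists (m * (\prod_(j <- r) f j t) + f i t * l).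
by apply: cder_ext (cderM fm fl) => x; rewrite big_cons.
Qed.

(** By the Leibniz expansion, the determinant is a signed sum of products of entries. *)
Lemma cderivable_det n (M : R -> 'M[R[i]]_n) t :
  mxderivable M t -> cderivable (fun x => \det (M x)) t.
Proof.
move=> dM; pose f (s : {perm 'I_n}) x := \prod_i M x i (s i).
have df s : cderivable (f s) t by apply: cderivable_prod => i; exact: dM.
have fl s : cder (f s) t (cderive (f s) t) by exact: df.
apply/cderP; exists (\sum_(s : {perm 'I_n}) (-1) ^+ s * cderive (f s) t).
by apply: cder_sum => s; apply: cderZ; exact: fl.
Qed.

(** * Entrywise calculus for rectangular matrix functions *)

Definition mxcder m n (M : R -> 'M[R[i]]_(m, n)) t (D : 'M[R[i]]_(m, n)) :=
  forall i j, cder (fun x => M x i j) t (D i j).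

Lemma mxderivable_mxcder n (M : R -> 'M[R[i]]_n) t :
  mxderivable M t -> mxcder M t (mxderive M t).
Proof. by move=> dM i j; rewrite mxE; exact: dM. Qed.

Lemma mxcder_mxderivable n (M : R -> 'M[R[i]]_n) t D :
  mxcder M t D -> mxderivable M t.
Proof. by move=> dM i j; apply/cderP; exists (D i j); exact: dM. Qed.

Lemma mxcder_near m n (M P : R -> 'M[R[i]]_(m, n)) t D :
  (\forall h \near 0^', M (t + h) = P (t + h)) ->
  M t = P t -> mxcder M t D -> mxcder P t D.
Proof.
move=> MP MPt dM i j; apply: cder_near (dM i j); last by rewrite MPt.
by apply: filterS MP => h ->.
Qed.

Lemma mxcder_ext m n (M P : R -> 'M[R[i]]_(m, n)) t D :
  M =1 P -> mxcder M t D -> mxcder P t D.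
Proof.
by move=> MP; apply: mxcder_near; [near=> h; rewrite MP | rewrite MP].
Unshelve. all: by end_near. Qed.

Lemma mxcder_uniq m n (M : R -> 'M[R[i]]_(m, n)) t D E :
  mxcder M t D -> mxcder M t E -> D = E.
Proof.
by move=> dD dE; apply/matrixP => i j; exact: cder_uniq (dD i j) (dE i j).
Qed.

Lemma mxcder_cst m n (M : 'M[R[i]]_(m, n)) t : mxcder (fun=> M) t 0.
Proof. by move=> i j; rewrite mxE; exact: cder_cst. Qed.

Lemma mxcderD m n (M P : R -> 'M[R[i]]_(m, n)) t D E :
  mxcder M t D -> mxcder P t E -> mxcder (fun x => M x + P x) t (D + E).
Proof.
move=> dD dE i j; rewrite mxE.
by apply: cder_ext (cderD (dD i j) (dE i j)) => x; rewrite mxE.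
Qed.

Lemma mxcderZ m n (c : R -> R[i]) (M : R -> 'M[R[i]]_(m, n)) t l D :
  cder c t l -> mxcder M t D ->
  mxcder (fun x => c x *: M x) t (l *: M t + c t *: D).
Proof.
move=> dc dM i j; rewrite !mxE.
by apply: cder_ext (cderM dc (dM i j)) => x; rewrite mxE.
Qed.

Lemma mxcder_scalar n (c : R -> R[i]) t l :
  cder c t l -> mxcder (fun x => (c x)%:M : 'M[R[i]]_n) t l%:M.
Proof.
move=> dc i j; rewrite mxE -mulr_natr mulrC.
by apply: cder_ext (@cderZ (i == j)%:R _ _ _ dc) => x;
  rewrite mxE mulrC mulr_natr.
Qed.

Lemma mxcder_mulmxl m n p (A : 'M[R[i]]_(m, n)) (M : R -> 'M[R[i]]_(n, p)) t D :
  mxcder M t D -> mxcder (fun x => A *m M x) t (A *m D).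
Proof.
move=> dM i j; rewrite mxE.
have := @cder_sum _ (index_enum _) xpredT _ _ _
  (fun k => @cderZ (A i k) _ _ _ (dM k j)).
by apply: cder_ext => x; rewrite mxE.
Qed.

Lemma mxcder_mulmxr m n p (A : 'M[R[i]]_(n, p)) (M : R -> 'M[R[i]]_(m, n)) t D :
  mxcder M t D -> mxcder (fun x => M x *m A) t (D *m A).
Proof.
move=> dM i j; rewrite mxE.
have := @cder_sum _ (index_enum _) xpredT _ _ _
  (fun k => @cderZ (A k j) _ _ _ (dM i k)).
rewrite (eq_bigr (fun k => D i k * A k j)) => [|k _]; last exact: mulrC.
apply: cder_ext => x; rewrite mxE; apply: eq_bigr => k _; exact: mulrC.
Qed.

Lemma mxcder_sum m n (I : Type) (r : seq I) (M : I -> R -> 'M[R[i]]_(m, n)) t D :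
  (forall i, mxcder (M i) t (D i)) ->
  mxcder (fun x => \sum_(i <- r) M i x) t (\sum_(i <- r) D i).
Proof.
move=> dM i j; rewrite summxE.
have := @cder_sum _ r xpredT _ _ _ (fun k => dM k i j); apply: cder_ext => x.
by rewrite summxE.
Qed.

(** The determinant is continuous at [t], so invertibility is an open condition. This serves both
    the derivative of the inverse and the differentiation of the Wronskian identity. *)
Lemma near_unitmx n (M : R -> 'M[R[i]]_n) t :
  mxderivable M t -> M t \in unitmx ->
  \forall h \near 0^', M (t + h) \in unitmx.
Proof.
move=> /cderivable_det/cderP[l dl]; rewrite unitmxE unitfE => M0.
have := cder_neq0 dl M0; apply: filterS => h.
by rewrite unitmxE unitfE.
Qed.

(** Cramer's formula: the inverse is the adjugate over the determinant, and each cofactor is a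
    signed determinant of a differentiable minor. *)
Lemma mxderivable_invmx n (M : R -> 'M[R[i]]_n) t :
  mxderivable M t -> M t \in unitmx -> mxderivable (fun x => invmx (M x)) t.
Proof.
move=> dM Mt.
have /cderP[l dl] := cderivable_det dM.
have M0 : \det (M t) != 0 by move: Mt; rewrite unitmxE unitfE.
have dadj : mxderivable (fun x => \adj (M x)) t.
  move=> i j; have dminor : mxderivable (fun x => row' j (col' i (M x))) t.
    move=> k k'; have := dM (lift j k) (lift i k'); congr (cderivable _ t).
    by apply/funext => x; rewrite !mxE.
  have /cderP[m dm] := cderivable_det dminor.
  apply/cderP; eexists; apply: cder_ext (@cderZ ((-1) ^+ (j + i)) _ _ _ dm) => x.
  by rewrite mxE.
have := mxcderZ (cderV M0 dl) (mxderivable_mxcder dadj).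
move=> /mxcder_near dinv; apply: mxcder_mxderivable (dinv _ _ _).
  (* [invmx] unfolds to the adjugate formula only at invertible matrices, hence only near [t]. *)
  have := near_unitmx dM Mt; apply: filterS => h Mh.
  by rewrite /invmx Mh.
by rewrite /invmx Mt.
Qed.
End Calculus.

(** * The generalized eigenfunctions, their Wronskian identity and unitarity *)

Section Model.
Variables (R : realType) (d r : nat) (a : R).
Variables (HC : 'M[R[i]]_d) (V : 'M[R[i]]_(d, r)).
Hypotheses (a_neq0 : a != 0) (hHC : HC^t* = HC).
Implicit Types (s t : R) (N n : nat).

Local Notation S := (Sth a HC V).
Local Notation G := (Gth a HC V).
Local Notation regular := (regular_angle a HC V).

Definition core t : 'M[R[i]]_(d, r) :=
  ((expi t)^-1 - expi t) *: (invmx (Fmx a HC V (expi t)) *m V).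

Lemma regular_unitmx t : regular t -> Fmx a HC V (expi t) \in unitmx.
Proof.
case=> ht nF; rewrite unitmxE unitfE; apply/eqP => F0.
by apply: nF; split.
Qed.

Lemma aC_neq0 : a%:C != 0.
Proof. by rewrite eq_complex /= negb_and a_neq0. Qed.

Lemma xz_expi t : xz a (expi t) = (xth a t)%:C.
Proof. by rewrite /xz expi_addV -rmorphM /xth mulrA [a * 2]mulrC. Qed.

Lemma GthE t n : G t n = (expi t ^+ n)%:M + expi t ^- n *: S t.
Proof. by rewrite /Gth expiN expiMn. Qed.

Lemma Sth_core t : S t = - 1%:M + (a%:C)^-1 *: (V^t* *m core t).
Proof.
rewrite /Sth /Smx /core -scalemxAr scalerA mulrC.
by rewrite mulmxA.
Qed.

(** Both [z ^+ n] and [z ^- n] solve the scalar recurrence, because [x = a (z + z^-1)]. *)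
Lemma Gth_rec t n : a%:C *: (G t n + G t n.+2) = (xth a t)%:C *: G t n.+1.
Proof.
rewrite -xz_expi /xz -scalerA; congr (_ *: _).
rewrite !GthE addrACA -[in LHS](raddfD (@scalar_mx _ r)) -scalerDl.
rewrite [in RHS]scalerDr scale_scalar_mx scalerA.
have z0 := expi_neq0 t; have w0 : expi t ^+ n != 0 by rewrite expf_neq0.
move: z0 w0; rewrite !exprS; move: (expi t ^+ n) (expi t) => w z z0 w0.
by congr (_%:M + _ *: _); field; rewrite ?z0 ?w0.
Qed.

(** The value [G t 0] is a fictitious site: with it, the equation of [J] at site 1, which involves
    the core, takes the form of the bulk recurrence. *)
Lemma core_Gth0 t : V^t* *m core t = a%:C *: G t 0.
Proof.
rewrite GthE expr0 invr1 scale1r Sth_core addrA subrr add0r scalerA.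
by rewrite divff ?scale1r// aC_neq0.
Qed.

(** With [core_Gth0], the first summand accounts for the [V *m V^t*] term of [Fmx], and the second
    for the right-hand side of the equation satisfied by [core t]. *)
Lemma Gth1 t : G t 1 = (expi t)^-1 *: G t 0 - ((expi t)^-1 - expi t)%:M.
Proof.
(* [S t] must be abstracted: as a sum up to conversion, it captures [scalerDr]. *)
rewrite !GthE; move: (S t) (expi t) => g z.
rewrite expr0 expr1 invr1 scale1r scalerDr scale_scalar_mx mulr1.
by rewrite raddfB /= opprB [RHS]addrC addrA subrK.
Qed.

Lemma core_Gth1 t : Fmx a HC V (expi t) \in unitmx ->
  HC *m core t + V *m G t 1 = (xth a t)%:C *: core t.
Proof.
move=> Fu.
have : Fmx a HC V (expi t) *m core t = ((expi t)^-1 - expi t) *: V.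
  by rewrite -scalemxAr mulKVmx.
rewrite Gth1 /Fmx !mulmxDl mulNmx mul_scalar_mx xz_expi -scalemxAl -mulmxA.
rewrite core_Gth0.
move: (core t) (G t 0) (expi t) => A g z.
rewrite -scalemxAr scalerA mulfVK ?aC_neq0// => e.
rewrite mulmxBr mul_mx_scalar -scalemxAr.
by rewrite -e opprD [X in _ + X]addrCA subrr addr0 opprB addrC subrK.
Qed.

Lemma Psi_core t alpha :
  Psi a HC V (expi t) alpha = (core t *m alpha, fun n => G t n *m alpha).
Proof.
rewrite /Psi /core scalemxAl; congr (_, _); apply/funext => n.
by rewrite GthE mulmxDl mul_scalar_mx scalemxAl.
Qed.

Lemma overlapE N s t :
  overlap a HC V N s t =
  (core s)^t* *m core t + \sum_(1 <= n < N.+1) (G s n)^t* *m G t n.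
Proof.
apply/matrixP => c e; rewrite [LHS]mxE [RHS]mxE summxE !Psi_core /inner /=.
rewrite adjmx_mulE; congr (_ + _).
  by apply: eq_bigr => j _; rewrite !mulmx_deltaE.
(* The sum over all positive sites reduces to sites 1 to [N]: beyond [N], [projN] makes the first
   argument zero. *)
rewrite -(@fsbig_widen _ _ _ _ [set` index_iota 1 N.+1]).
- rewrite -fsbig_seq ?iota_uniq//; apply: eq_big_seq => n.
  rewrite mem_index_iota ltnS adjmx_mulE => ->.
  by apply: eq_bigr => k _; rewrite !mulmx_deltaE.
- by move=> n /=; rewrite mem_index_iota => /andP[].
- move=> n [/= n0]; rewrite mem_index_iota n0 ltnS /= => /negP/negbTE ->.
  by rewrite big1// => k _; rewrite mxE mul0r.
Qed.

(** Assuming only invertibility of [Fmx] permits [s = t] and [N = 0], needed for unitarity, and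
    makes the identity available on a neighbourhood of a regular angle, needed for
    differentiation. *)
Lemma overlap_green N s t :
  Fmx a HC V (expi s) \in unitmx -> Fmx a HC V (expi t) \in unitmx ->
  (xth a s - xth a t)%:C *: overlap a HC V N s t =
  a%:C *: ((G s N.+1)^t* *m G t N - (G s N)^t* *m G t N.+1).
Proof.
move=> hs ht; rewrite overlapE rmorphB /=.
apply: (truncated_green (H := HC) (V := V)); rewrite ?conj_realC//.
- exact: core_Gth1.
- exact: core_Gth0.
- exact: Gth_rec.
- exact: core_Gth1.
- exact: core_Gth0.
- exact: Gth_rec.
Qed.

Lemma expi_subV_neq0 t : regular t -> expi t - (expi t)^-1 != 0.
Proof.
case=> /sin_gt0_pi st _; rewrite expi_subV mulf_neq0//.
  by rewrite eq_complex /= oner_eq0 andbF.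
by rewrite eq_complex /= eqxx andbT mulf_neq0// gt_eqF.
Qed.

Lemma Sth_unitary t : regular t -> (S t)^t* *m S t = 1%:M.
Proof.
move=> ht; have Fu := regular_unitmx ht; have := overlap_green 0 Fu Fu.
rewrite subrr scale0r => /esym/eqP.
rewrite scaler_eq0 (negPf aC_neq0) subr_eq0 /= => /eqP.
apply: unitary_of_wronskian (conj_expi t) (expi_subV_neq0 ht) _ _.
  by rewrite GthE expr0 invr1 scale1r.
by rewrite GthE expr1.
Qed.

(** * Differentiation in the angle and the diagonal formula *)

Lemma mxderivable_Fmx t : mxderivable (fun x => Fmx a HC V (expi x)) t.
Proof.
have dF := mxcderD
  (mxcderD (mxcder_cst HC t)
    (mxcderZ (cder_cst (- 1) t) (mxcder_scalar (n := d) (@cder_xth R a t))))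
  (mxcderZ (cderM (@cder_expiV R t) (cder_cst (a%:C)^-1 t))
    (mxcder_cst (V *m V^t* ) t)).
apply: mxcder_mxderivable (_ : mxcder _ t _); apply: mxcder_ext dF => x.
by rewrite scaleN1r -xz_expi.
Qed.

Lemma core_cder t : Fmx a HC V (expi t) \in unitmx ->
  exists D, mxcder core t D.
Proof.
move=> Fu; have dI := mxderivable_invmx (@mxderivable_Fmx t) Fu.
have dC := mxcderZ (cderD (@cder_expiV R t) (cderN (@cder_expi1 R t)))
  (mxcder_mulmxr (A := V) (mxderivable_mxcder dI)).
by eexists; apply: mxcder_ext dC => x.
Qed.

Lemma mxderivable_Sth t : Fmx a HC V (expi t) \in unitmx -> mxderivable S t.
Proof.
move=> /core_cder[D dD]; have dS := mxcderD (mxcder_cst (- 1%:M) t)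
  (mxcderZ (cder_cst (a%:C)^-1 t) (mxcder_mulmxl (A := V^t*) dD)).
apply: mxcder_mxderivable (_ : mxcder _ t _); apply: mxcder_ext dS => x.
by rewrite Sth_core.
Qed.

Lemma Gth_cder t n : Fmx a HC V (expi t) \in unitmx ->
  mxcder (fun x => G x n) t
    (('i * n%:R * expi t ^+ n)%:M - ('i * n%:R * expi t ^- n) *: S t
     + expi t ^- n *: mxderive S t).
Proof.
move=> /mxderivable_Sth/mxderivable_mxcder dS.
have := mxcderD (mxcder_scalar (n := r) (@cder_expi R n%:R t))
  (mxcderZ (@cder_expi R (- n%:R) t) dS).
rewrite rmorphN !rmorph_nat mulNr expiN expiMn mulrN mulNr scaleNr addrA.
by apply: mxcder_ext => x; rewrite mulNr.
Qed.

(** Existence suffices: at [t = s] this derivative gets multiplied by [xth a s - xth a t], which is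
    zero there. *)
Lemma overlap_cder N s t : Fmx a HC V (expi t) \in unitmx ->
  exists D, mxcder (overlap a HC V N s) t D.
Proof.
move=> Fu; have [D dD] := core_cder Fu.
have dG := mxcder_sum (r := index_iota 1 N.+1)
  (fun n => mxcder_mulmxl (A := (G s n)^t*) (@Gth_cder t n Fu)).
have dO := mxcderD (mxcder_mulmxl (A := (core s)^t*) dD) dG.
by eexists; apply: mxcder_ext dO => x; rewrite overlapE.
Qed.

Lemma overlap_diag N t : regular t ->
  overlap a HC V N t t = ((2 * N + 1)%:R)%:M + 'i *: ((S t)^t* *m mxderive S t) +
    ('i / (2 * sin t)%:C) *:
      (expi (- ((2 * N + 1)%:R * t)) *: S t
       - expi ((2 * N + 1)%:R * t) *: (S t)^t* ).
Proof.
move=> ht; have Fu := regular_unitmx ht.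
have w0 : (2 * sin t)%:C != 0.
  case: ht => /sin_gt0_pi st _.
  by rewrite eq_complex /= eqxx andbT mulf_neq0// gt_eqF.
have [D dD] := @overlap_cder N t t Fu.
(* The two sides of the Wronskian identity are differentiated in the second angle at [t], with the
   first angle frozen at [t]. *)
have dL := mxcderZ
  (cderD (cder_cst (xth a t)%:C t) (cderN (@cder_xth R a t))) dD.
have dR := mxcderZ (cder_cst a%:C t)
  (mxcderD (mxcder_mulmxl (A := (G t N.+1)^t*) (@Gth_cder t N Fu))
     (mxcderZ (cder_cst (- 1) t)
       (mxcder_mulmxl (A := (G t N)^t*) (@Gth_cder t N.+1 Fu)))).
have gN x : Fmx a HC V (expi x) \in unitmx ->
    ((xth a t)%:C - (xth a x)%:C) *: overlap a HC V N t x =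
    a%:C *: ((G t N.+1)^t* *m G x N + -1 *: ((G t N)^t* *m G x N.+1)).
  by move=> Fx; rewrite scaleN1r -rmorphB; exact: overlap_green.
have gnear : \forall h \near 0^',
    ((xth a t)%:C - (xth a (t + h))%:C) *: overlap a HC V N t (t + h) =
    a%:C *: ((G t N.+1)^t* *m G (t + h) N +
             -1 *: ((G t N)^t* *m G (t + h) N.+1)).
  by have := near_unitmx (@mxderivable_Fmx t) Fu; apply: filterS => h; exact: gN.
have e := mxcder_uniq (mxcder_near gnear (gN t Fu) dL) dR.
have dw := diagonal_wronskian (mxderive S t) N (conj_expi t) (expi_neq0 t)
  (Sth_unitary ht) (sqr_i R) (expi_subV t) w0.
rewrite -(GthE t N) -(GthE t N.+1) in dw.
(* The unknown [D] drops out, as do the terms coming from constant coefficients. *)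
move: e; rewrite [X in X *: D]subrr [0 *: D]scale0r addr0 sub0r.
rewrite [0 *: (_ + _)]scale0r add0r [0 *: (_ *m _)]scale0r add0r scaleN1r dw.
rewrite -rmorphN opprK scalerA => e.
have aw : (2 * a * sin t)%:C = a%:C * (2 * sin t)%:C.
  by rewrite -rmorphM mulrCA mulrA.
(* This nonzero scalar is the derivative of [xth a t - xth a x] in [x] at [t]. *)
apply: (scalerI (a := a%:C * (2 * sin t)%:C)).
  by rewrite mulf_neq0 ?aC_neq0.
by rewrite -{1}aw e expiN expiMn.
Qed.
End Model.

Theorem theorem2p7 (R : realType) (q d r : nat)
    (HC : 'M[R[i]]_d) (V : 'M[R[i]]_(d, r))
    (hq : prime_power q) (hd : (1 <= d)%N) (hr : (1 <= r)%N)
    (hHC : HC \is hermsymmx) :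
  let a : R := Num.sqrt q%:R in
  let S := Sth a HC V in
  let G := Gth a HC V in
  let dS := mxderive S in
  let term1 (N : nat) : 'M[R[i]]_r := ((2 * N + 1)%:R)%:M in
  let term2 (t : R) : 'M[R[i]]_r := 'i *: ((S t)^t* *m dS t) in
  let term3 (N : nat) (t : R) : 'M[R[i]]_r :=
    ('i / (2 * sin t)%:C) *:
      (expi (- ((2 * N + 1)%:R * t)) *: S t
       - expi ((2 * N + 1)%:R * t) *: (S t)^t*) in
  [/\ forall (N : nat) (s t : R), (1 <= N)%N ->
        regular_angle a HC V s -> regular_angle a HC V t -> s <> t ->
        (xth a s - xth a t)%:C *: overlap a HC V N s t =
        a%:C *: ((G s N.+1)^t* *m G t N - (G s N)^t* *m G t N.+1),
      forall t : R, regular_angle a HC V t -> (S t)^t* *m S t = 1%:M,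
      forall t : R, regular_angle a HC V t -> mxderivable S t,
      forall (N : nat) (t : R), (1 <= N)%N -> regular_angle a HC V t ->
        overlap a HC V N t t = term1 N + term2 t + term3 N t &
      forall (N : nat) (t : R), (1 <= N)%N -> regular_angle a HC V t ->
        [/\ term1 N \is hermsymmx, term2 t \is hermsymmx
          & term3 N t \is hermsymmx]].
Proof.
have q0 : (0 < q)%N by case: hq => p [k [pp _ ->]]; rewrite expn_gt0 prime_gt0.
move=> a S G dS term1 term2 term3.
have a0 : a != 0 by rewrite /a sqrtr_eq0 -ltNge ltr0n.
have hH : HC^t* = HC by apply/hermsymmxP.
have diag N t : regular_angle a HC V t ->
    overlap a HC V N t t = term1 N + term2 t + term3 N t.
  exact: overlap_diag.
have h1 N : (term1 N)^t* = term1 N by rewrite adjmx_scalar rmorph_nat.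
(* The adjoint exchanges the two summands; the resulting sign is absorbed by the conjugate of
   ['i]. *)
have h3 N t : (term3 N t)^t* = term3 N t.
  rewrite /term3 adjmxZ adjmxB !adjmxZ adjmxK rmorphM fmorphV /= conj_realC.
  by rewrite !conj_expi !expiN invrK conj_i mulNr scaleNr -scalerN opprB.
(* At equal angles the overlap is a sum of matrices of the form [A^t* *m A]. *)
have hO N t : (overlap a HC V N t t)^t* = overlap a HC V N t t.
  rewrite overlapE adjmxD adjmxM adjmxK adjmx_sum; congr (_ + _).
  by apply: eq_bigr => n _; rewrite adjmxM adjmxK.
split.
- move=> N s t _ hs ht _.
  by apply: overlap_green => //; exact: regular_unitmx.
- by move=> t; exact: Sth_unitary.
- by move=> t ht; apply: mxderivable_Sth => //; exact: regular_unitmx.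
- by move=> N t _; exact: diag.
move=> N t _ ht; split; apply/hermsymmxP => //.
(* Hermiticity of [term2] is read off from the diagonal formula, all of whose other members are
   Hermitian, rather than by differentiating the unitarity relation. *)
have -> : term2 t = overlap a HC V N t t - term1 N - term3 N t.
  by rewrite diag// [_ - term1 N]addrAC [term1 N + _]addrC !addrK.
by rewrite !adjmxB hO h1 h3.
Qed.
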